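(* Let $p>0$ and let $\mathcal{S}_p=\{x^{-p}e^{ix} : 1<x<\infty\}\subset\mathbb{C}$. Let $\alpha\in(0,1]$. If $f:(0,1)\to\mathcal{S}_p$ is an $\alpha$-Hölder homeomorphism (onto $\mathcal{S}_p$), then $\alpha<p$.
   Context: For $X\subset\mathbb{C}$ and $\alpha\in(0,1]$, a function $f:X\to\mathbb{C}$ is $\alpha$-Hölder if there is a constant $C>0$ such that $|f(x)-f(y)|\leq C|x-y|^\alpha$ for all $x,y\in X$. The set $\mathcal{S}_p\subset\mathbb{C}$ carries the subspace topology. *)

(* Defs.v *)
From HB Require Import structures.
From mathcomp Require Import all_boot all_order all_algebra.
From mathcomp Require Import complex.
From mathcomp Require Import all_classical all_reals all_analysis.

Set Implicit Arguments.
Unset Strict Implicit.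
Unset Printing Implicit Defensive.

Import Order.TTheory GRing.Theory Num.Theory.
Import numFieldNormedType.Exports.

Local Open Scope classical_set_scope.
Local Open Scope ring_scope.
Local Open Scope complex_scope.

(* The library only puts the norm topology on [F^o], or on [F] itself when [F]
   is an abstract numeric field; [R[i]] is neither. *)
HB.instance Definition _ (R : realType) := NormedModule.copy R[i] R[i]^o.

(* [f] is total, but only its restriction to [A] matters: [{within A, _}] is
   continuity for the subspace topology of [A]. *)
Definition homeomorphism_on (T : ptopologicalType) (U : topologicalType)
    (A : set T) (B : set U) (f : T -> U) : Prop :=
  [/\ set_bij A B f,
      {within A, continuous f} &
      exists2 g : U -> T, {in A, cancel f g} & {within B, continuous g}].

(* [normc] is the modulus with values in [R]; [`|z|] has type [R[i]]. *)
Definition holder_on (R : realType) (alpha : R) (X : set R[i])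
    (f : R[i] -> R[i]) : Prop :=
  exists2 C : R, 0 < C & forall x y, X x -> X y ->
    Normc.normc (f x - f y) <= C * Normc.normc (x - y) `^ alpha.

Definition expC (R : realType) (z : R[i]) : R[i] :=
  (expR (complex.Re z))%:C * (cos (complex.Im z) +i* sin (complex.Im z)).

Definition spiral (R : realType) (p : R) : set R[i] :=
  [set (x `^ (- p))%:C * expC ('i * x%:C) | x in [set x : R | 1 < x]].

Definition unit_interval (R : realType) : set R[i] :=
  [set t%:C | t in [set t : R | 0 < t < 1]].
Arguments unit_interval R : clear implicits.

(* Main.v *)
(* Half-turns of the spiral are separated: the points of parameters x and x + pi
   are at distance x^-p + (x + pi)^-p >= x^-p.  Pulling back the spiral by f gives
   a continuous injection, hence a monotone one, of ]1, +oo[ into ]0, 1[, so the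
   preimages t_k of the points of parameters k * pi form a monotone sequence of
   total variation at most 1.  The Hoelder bound yields
   |t_(k+1) - t_k| >= c * (k * pi)^(-p / alpha), which for p <= alpha dominates
   the divergent harmonic series. *)
Require Import Defs.
From mathcomp Require Import all_boot all_order all_algebra.
From mathcomp Require Import complex.
From mathcomp Require Import all_classical all_reals all_analysis.
From mathcomp Require Import ring lra.

Import Order.TTheory GRing.Theory Num.Theory.
Import numFieldNormedType.Exports.

Local Open Scope ring_scope.
Local Open Scope complex_scope.

Lemma continuous_Re (R : realType) : continuous (fun z : R[i] => complex.Re z).
Proof.
move=> z; apply/(@cvgrPdist_lt _ _ _ _ (nbhs_filter z)) => e e0.
have eC : 0 < e%:C :> R[i] by rewrite ltcR.
have := @cvgr_dist_lt _ R[i] _ _ (nbhs_filter z) id z cvg_id _ eC.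
apply: (@filterS _ _ (nbhs_filter z)) => w zw.
by rewrite -ltcR -raddfB (le_lt_trans (normc_ge_Re _)).
Qed.

Lemma cvg_complex (R : realType) (T : Type) (F : set_system T) (FF : Filter F)
    (u v : T -> R) (a b : R) :
  (u t @[t --> F] --> a)%classic -> (v t @[t --> F] --> b)%classic ->
  ((u t +i* v t : R[i]) @[t --> F] --> (a +i* b : R[i]))%classic.
Proof.
(* The radius is a positive element of [R[i]], and the order there forces its imaginary part to
   vanish. *)
move=> ua vb; apply/cvgrPdist_lt => -[e e']; rewrite ltcE/= => /andP[/eqP-> e0].
have e20 : 0 < e / 2 by rewrite divr_gt0.
near=> t; rewrite [X in X < _]normc_def ltcR/=.
have ha : `|a - u t| < e / 2 by near: t; apply: cvgr_dist_lt ua _ e20.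
have hb : `|b - v t| < e / 2 by near: t; apply: cvgr_dist_lt vb _ e20.
apply: (@le_lt_trans _ _ (`|a - u t| + `|b - v t|)); last by lra.
(* The modulus is at most the sum of the coordinate distances: compare squares, the cross term being
   nonnegative. *)
rewrite -(ger0_norm (addr_ge0 (normr_ge0 (a - u t)) (normr_ge0 (b - v t)))).
rewrite -sqrtr_sqr ler_wsqrtr// -(real_normK (num_real (a - u t))).
rewrite -(real_normK (num_real (b - v t))) sqrrD -addrA lerD2l lerDr.
by rewrite mulrn_wge0// mulr_ge0.
Unshelve. all: by end_near. Qed.

(** Cartesian form of the parametrization in [spiral], so that continuity and moduli can be read off
    the coordinates. *)
Definition spiral_arc {R : realType} (p x : R) : R[i] :=
  (x `^ (- p) * cos x) +i* (x `^ (- p) * sin x).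

Lemma spiral_arcE (R : realType) (p x : R) :
  (x `^ (- p))%:C * expC ('i * x%:C) = spiral_arc p x.
Proof.
rewrite /expC /spiral_arc; simpc => /=.
by rewrite !(mul0r, mulr0, mul1r, subr0, addr0, add0r, oppr0, expR0).
Qed.

Lemma spiral_spiral_arc (R : realType) (p x : R) :
  1 < x -> spiral p (spiral_arc p x).
Proof. by move=> x1; exists x => //; exact: spiral_arcE. Qed.

Lemma normc_polar (R : realType) (r x : R) :
  0 <= r -> Normc.normc ((r * cos x) +i* (r * sin x)) = r.
Proof.
by move=> r0; rewrite /= !exprMn -mulrDr cos2Dsin2 mulr1 sqrtr_sqr ger0_norm.
Qed.

Lemma normc_spiral_arc (R : realType) (p x : R) :
  Normc.normc (spiral_arc p x) = x `^ (- p).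
Proof. by rewrite normc_polar// powR_ge0. Qed.

(** The modulus x^-p already determines x: raise it to the power -1/p. *)
Lemma spiral_arc_inj (R : realType) (p : R) : p != 0 ->
  {in Num.nneg &, injective (spiral_arc p)}.
Proof.
move=> p0 x y x0 y0 /(congr1 (@Normc.normc R)); rewrite !normc_spiral_arc.
move=> /(congr1 (fun z => z `^ (- p)^-1)).
by rewrite -!powRrM divff ?oppr_eq0// !powRr1.
Qed.

Lemma continuous_spiral_arc (R : realType) (p x : R) : 0 < x ->
  {for x, continuous (spiral_arc p)}.
Proof.
move=> x0.
have cp : {for x, continuous (fun y : R => y `^ (- p))}.
  apply: differentiable_continuous; apply/derivable1_diffP.
  by have [] := is_derive1_powR (- p) x0.
apply: cvg_complex.
- by apply: cvgM; [exact: cp | exact: continuous_cos].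
- by apply: cvgM; [exact: cp | exact: continuous_sin].
Qed.

Lemma spiral_arc_half_turn (R : realType) (p x : R) :
  x `^ (- p) <= Normc.normc (spiral_arc p (x + pi) - spiral_arc p x).
Proof.
rewrite -normcN opprB.
have -> : spiral_arc p x - spiral_arc p (x + pi) =
    ((x `^ (- p) + (x + pi) `^ (- p)) * cos x) +i*
    ((x `^ (- p) + (x + pi) `^ (- p)) * sin x).
  rewrite /spiral_arc cosDpi sinDpi; simpc.
  by congr (_ +i* _); ring.
by rewrite normc_polar ?addr_ge0 ?powR_ge0// lerDl powR_ge0.
Qed.

(** Otherwise the increments telescope and bound every harmonic partial sum by 2M/c, so the harmonic
    series would converge. *)
Lemma monotone_series_harmonic (R : realType) (t : nat -> R) (c M : R) :
  (forall n, `|t n| <= M) -> 0 < c ->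
  ~ (forall n, c * n.+1%:R^-1 <= t n.+1 - t n).
Proof.
move=> tM c0 ht; apply: (@dvg_harmonic R).
apply: nondecreasing_is_cvgn.
  move=> m n mn; rewrite -subr_ge0 sub_series_geq// sumr_ge0// => i _.
  by rewrite /= invr_ge0.
exists ((M + M) / c) => _ [n _ <-].
rewrite ler_pdivlMr// mulrC /series/= mulr_sumr.
apply: (@le_trans _ _ (\sum_(0 <= k < n) (t k.+1 - t k))).
  by apply: ler_sum => i _.
rewrite telescope_sumr// lerD//.
  exact: le_trans (ler_norm _) (tM _).
by rewrite (le_trans (ler_norm _))// normrN.
Qed.

(** Taking 1/alpha-th powers gives d >= (x^-p / C)^(1/alpha), and x^(-p/alpha) >= x^-1 because x >=
    1 and p/alpha <= 1. *)
Lemma spiral_param_holder_bound (R : realType) (p alpha C x d : R) :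
  0 < alpha -> p <= alpha -> 0 < C -> 1 <= x -> 0 <= d ->
  x `^ (- p) <= C * d `^ alpha -> C^-1 `^ alpha^-1 * x^-1 <= d.
Proof.
move=> a0 pa C0 x1 d0 h.
have x0 : 0 < x by apply: lt_le_trans x1.
have aV0 : 0 <= alpha^-1 by rewrite invr_ge0 ltW.
rewrite -[leRHS]powRr1// -(@mulfV _ alpha) ?gt_eqF// powRrM.
apply: (@le_trans _ _ ((C^-1 * x `^ (- p)) `^ alpha^-1)); last first.
  apply: ge0_ler_powR => //; rewrite ?nnegrE ?mulr_ge0 ?powR_ge0 ?invr_ge0 ?(ltW C0)//.
  by rewrite mulrC ler_pdivrMr// mulrC.
rewrite powRM ?invr_ge0 ?powR_ge0 ?(ltW C0)// ler_pM2l ?powR_gt0 ?invr_gt0//.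
rewrite -powRrM -powR_inv1 ?(ltW x0)// ler_powR// mulNr lerN2.
by rewrite ler_pdivrMr// mul1r.
Qed.

Theorem theorem2p1 (R : realType) (p alpha : R) (f : R[i] -> R[i])
  (hp : 0 < p)
  (halpha : 0 < alpha <= 1)
  (hhomeo : homeomorphism_on (unit_interval R) (spiral p) f)
  (hholder : holder_on alpha (unit_interval R) f) :
  alpha < p.
Proof.
rewrite ltNge; apply/negP => pa.
have /andP[a0 _] := halpha.
have [[_ _ fsurj] _ [g fK gc]] := hhomeo.
have [C C0 fC] := hholder.
(* For x > 1 the value of [g] lies in the unit interval, hence is real, and taking [complex.Re]
   loses nothing. *)
pose phi (x : R) := complex.Re (g (spiral_arc p x)).
have phiP x : 1 < x -> 0 < phi x < 1 /\ f (phi x)%:C = spiral_arc p x.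
  move=> x1; have [_ [t t01 <-] ftE] := fsurj _ (spiral_spiral_arc _ p _ x1).
  have -> : phi x = t by rewrite /phi -ftE fK//; apply/mem_set; exists t.
  by split.
have phi_inj : {in `]1, +oo[ &, injective phi}.
  move=> x y; rewrite !in_itv/= !andbT => x1 y1 xy.
  apply: (@spiral_arc_inj _ p).
  - by rewrite gt_eqF.
  - by rewrite nnegrE ltW// (lt_trans _ x1).
  - by rewrite nnegrE ltW// (lt_trans _ y1).
  by rewrite -(phiP _ x1).2 -(phiP _ y1).2 xy.
have phi_cont : {within [set` `]1, +oo[%R], continuous phi}%classic.
  apply/subspace_continuousP => x /=; rewrite in_itv/= andbT => x1.
  apply: (@cvg_comp _ _ _ (g \o spiral_arc p) (@complex.Re R) _
    (nbhs (g (spiral_arc p x)))); last exact: continuous_Re.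
  move/subspace_continuousP : gc => /(_ _ (spiral_spiral_arc _ p _ x1)).
  (* [g] is continuous only along the spiral; parameters z > 1 near x stay on it, so the relative
     neighbourhood pulls back. *)
  apply: (cvg_comp (spiral_arc p)) => U /=; rewrite {1}/within/= => hU.
  have x0 : 0 < x by rewrite (lt_trans _ x1).
  have := @continuous_spiral_arc _ p _ x0 _ hU.
  apply: (@filterS _ _ (nbhs_filter x)) => z /= zU; rewrite in_itv/= andbT => z1.
  exact/zU/spiral_spiral_arc.
(* Starting at pi rather than 0 keeps every parameter above 1. *)
pose y n : R := pi * n.+1%:R.
have y1 n : 1 < y n.
  rewrite /y (lt_le_trans _ (ler_peMr (pi_ge0 R) _)) ?ler1n//.
  by have := pi_ge2 R; lra.
have yS n : y n.+1 = y n + pi by rewrite /y -natr1 mulrDr mulr1.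
(* The factor 1/pi turns the bound in 1 / [y n] into one in 1/(n+1). *)
pose c := C^-1 `^ alpha^-1 * pi^-1.
have c0 : 0 < c by rewrite mulr_gt0 ?powR_gt0 ?invr_gt0// pi_gt0.
have phi_step n : c * n.+1%:R^-1 <= `|phi (y n.+1) - phi (y n)|.
  rewrite /c -mulrA -invfM; apply: (@spiral_param_holder_bound _ p) => //.
    exact/ltW/y1.
  have [in1 f1] := phiP _ (y1 n); have [in2 f2] := phiP _ (y1 n.+1).
  apply: (le_trans (spiral_arc_half_turn _ p _)); rewrite -/(y n) -yS -f1 -f2.
  have -> : `|phi (y n.+1) - phi (y n)| =
      Normc.normc ((phi (y n.+1))%:C - (phi (y n))%:C).
    by rewrite -rmorphB/= expr0n addr0 sqrtr_sqr.
  by apply: fC; [exists (phi (y n.+1)) | exists (phi (y n))].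
have phi_bnd n : `|phi (y n)| <= 1.
  have [/andP[h0 h1] _] := phiP _ (y1 n).
  by rewrite gtr0_norm// ltW.
have yin n : y n \in `]1, +oo[ by rewrite in_itv/= y1.
have ylt n : y n < y n.+1 by rewrite yS ltrDl pi_gt0.
have [phi_mono|phi_mono] := itv_continuous_inj_mono phi_cont phi_inj.
- apply: (@monotone_series_harmonic _ (phi \o y) c 1) => // n.
  rewrite (le_trans (phi_step n))// ger0_norm// subr_ge0.
  by rewrite ltW// phi_mono.
(* When [phi] decreases, its negative has the required positive increments. *)
- apply: (@monotone_series_harmonic _ (fun n => - phi (y n)) c 1) => // n.
    by rewrite normrN.
  have phi_le : phi (y n.+1) <= phi (y n) by rewrite ltW// phi_mono.
  by rewrite (le_trans (phi_step n))// ler0_norm ?subr_le0// opprD.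
Qed.
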